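(* There exists an approximation preserving reduction from the MAX-IS problem to the MAX-0-1-TMT-MULT problem.
   Context: MAX-IS: given a finite static graph $G=(V,E)$, find a maximum-cardinality independent set $I\subseteq V$ (no two nodes of $I$ adjacent). A temporal graph $\mathcal{G}=(\mathcal{V},\mathcal{E})$ with lifetime $\mathcal{T}$ has a finite node set and a finite edge set; each edge joins two distinct nodes (at most one edge per pair) and is associated with a nonempty list of time intervals $[s_1,f_1),\dots,[s_k,f_k)$ with integers $0\le s_1<f_1<s_2<\dots<s_k<f_k\le\mathcal{T}$, existing at each integer timestep in one of them. A rooted temporal tree is a temporal graph whose underlying static graph (edge $\{u,v\}$ per temporal edge) is a tree, with a designated root. Two distinct edges overlap if they share an endpoint and exist at a common timestep; a 0-1 timed matching is a set of edges no two of which overlap. MAX-0-1-TMT-MULT: given a rooted temporal tree in which edges may be associated with multiple time intervals, find a maximum-cardinality 0-1 timed matching. An approximation preserving reduction from MAX-IS to MAX-0-1-TMT-MULT is a pair of polynomial-time computable maps: $f$, sending each graph $G$ to a rooted temporal tree $f(G)$, and $g$, sending each 0-1 timed matching $M$ of $f(G)$ to an independent set $g(M)$ of $G$, such that for every $\rho$, whenever $M$ is a $\rho$-approximate solution for $f(G)$ (i.e. $|M|\ge\rho\cdot\mathrm{OPT}(f(G))$), $g(M)$ is a $\rho$-approximate solution for $G$. *)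

(* Defs.v *)
From HB Require Import structures.
From mathcomp Require Import all_boot all_order all_algebra.

Set Implicit Arguments.
Unset Strict Implicit.
Unset Printing Implicit Defensive.

Import Order.TTheory GRing.Theory Num.Theory.

(* Polynomial time is defined through N. Jones's WHILE language: imperative
   programs over binary trees, with unboundedly many registers.  A step is
   charged the sizes of all the trees it handles, not one unit, so that a
   running time bounds the size of every tree built (no exponential growth by
   sharing) and polynomial time here is polynomial time on Turing machines. *)

Inductive data := DNil | DCons of data & data.

Fixpoint data_eqb (x y : data) : bool :=
  match x, y with
  | DNil, DNil => true
  | DCons x1 x2, DCons y1 y2 => data_eqb x1 y1 && data_eqb x2 y2
  | _, _ => false
  end.

Fixpoint data_size (x : data) : nat :=
  if x is DCons x1 x2 then (data_size x1 + data_size x2).+1 else 1.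

Definition data_hd (x : data) : data := if x is DCons y _ then y else DNil.
Definition data_tl (x : data) : data := if x is DCons _ y then y else DNil.

Definition data_of_bool (b : bool) : data := if b then DCons DNil DNil else DNil.

Definition bool_of_data (x : data) : bool := if x is DNil then false else true.

Definition store := nat -> data.

Definition update (s : store) (i : nat) (x : data) : store :=
  fun j => if j == i then x else s j.

Inductive expr :=
  | EVar of nat
  | ENil
  | ECons of expr & expr
  | EHd of expr
  | ETl of expr
  | EEq of expr & expr.

Fixpoint eval (s : store) (e : expr) : data :=
  match e with
  | EVar i => s i
  | ENil => DNil
  | ECons e1 e2 => DCons (eval s e1) (eval s e2)
  | EHd e1 => data_hd (eval s e1)
  | ETl e1 => data_tl (eval s e1)
  | EEq e1 e2 => data_of_bool (data_eqb (eval s e1) (eval s e2))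
  end.

(* The sum of the sizes of the values of all the subexpressions. *)
Fixpoint eval_cost (s : store) (e : expr) : nat :=
  data_size (eval s e) +
  match e with
  | EVar _ | ENil => 0
  | ECons e1 e2 | EEq e1 e2 => eval_cost s e1 + eval_cost s e2
  | EHd e1 | ETl e1 => eval_cost s e1
  end.

Inductive cmd :=
  | CAssign of nat & expr
  | CSeq of cmd & cmd
  | CIf of expr & cmd & cmd
  | CWhile of expr & cmd.

(* exec c s t s' : started in s, the command c halts in s' after time t. *)
Inductive exec : cmd -> store -> nat -> store -> Prop :=
  | XAssign i e s :
      exec (CAssign i e) s (eval_cost s e).+1 (update s i (eval s e))
  | XSeq c1 c2 s t1 s1 t2 s2 :
      exec c1 s t1 s1 -> exec c2 s1 t2 s2 ->
      exec (CSeq c1 c2) s (t1 + t2).+1 s2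
  | XIfTrue e c1 c2 s t s' :
      bool_of_data (eval s e) -> exec c1 s t s' ->
      exec (CIf e c1 c2) s (eval_cost s e + t).+1 s'
  | XIfFalse e c1 c2 s t s' :
      ~~ bool_of_data (eval s e) -> exec c2 s t s' ->
      exec (CIf e c1 c2) s (eval_cost s e + t).+1 s'
  | XWhileTrue e c s t1 s1 t2 s2 :
      bool_of_data (eval s e) -> exec c s t1 s1 ->
      exec (CWhile e c) s1 t2 s2 ->
      exec (CWhile e c) s (eval_cost s e + t1 + t2).+1 s2
  | XWhileFalse e c s :
      ~~ bool_of_data (eval s e) ->
      exec (CWhile e c) s (eval_cost s e).+1 s.

(* The input is given, and the output returned, in register 0. *)
Definition init_store (x : data) : store := update (fun=> DNil) 0 x.

(* The promise D restricts the inputs on which the program is required to be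
   correct and fast. *)
Definition poly_time_computable (A : Type) (D : A -> Prop)
    (input output : A -> data) : Prop :=
  exists (c : cmd) (q : {poly nat}), forall a : A, D a ->
    exists (t : nat) (s : store),
      [/\ exec c (init_store (input a)) t s,
          s 0 = output a
        & t <= (q.[data_size (input a)])%R].

Definition enc_seq (T : Type) (enc : T -> data) (l : seq T) : data :=
  foldr (fun x d => DCons (enc x) d) DNil l.

Definition enc_pair (T U : Type) (encT : T -> data) (encU : U -> data)
    (p : T * U) : data := DCons (encT p.1) (encU p.2).

(* Binary, least significant bit first, 0 being the empty list of bits. *)
Fixpoint enc_pos (p : BinNums.positive) : data :=
  match p with
  | BinNums.xH => DCons (data_of_bool true) DNil
  | BinNums.xO p' => DCons (data_of_bool false) (enc_pos p')
  | BinNums.xI p' => DCons (data_of_bool true) (enc_pos p')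
  end.

Definition enc_nat (n : nat) : data :=
  if bin_of_nat n is BinNums.Npos p then enc_pos p else DNil.

Definition enc_ord (n : nat) (i : 'I_n) : data := enc_nat i.

(* candidate x also contains the candidates that are not feasible. *)
Record max_problem := MaxProblem {
  instance : Type;
  candidate : instance -> finType;
  feasible : forall x : instance, pred (candidate x);
  value : forall x : instance, candidate x -> nat;
  enc_instance : instance -> data;
  enc_candidate : forall x : instance, candidate x -> data
}.

Definition OPT (P : max_problem) (x : instance P) : nat :=
  \max_(y : candidate x | feasible y) value y.

Definition approximate_solution (P : max_problem) (R : realFieldType) (rho : R)
    (x : instance P) (y : candidate x) : Prop :=
  feasible y /\ (rho * (OPT x)%:R <= (value y)%:R)%R.

Record approximation_preserving (P Q : max_problem)
    (f : instance P -> instance Q)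
    (g : forall x : instance P, candidate (f x) -> candidate x) : Prop := {
  ap_f_poly :
    poly_time_computable (fun _ : instance P => True)
      (fun x => enc_instance x) (fun x => enc_instance (f x));
  ap_g_poly :
    poly_time_computable
      (fun xy : {x : instance P & candidate (f x)} => feasible (tagged xy))
      (fun xy => DCons (enc_instance (tag xy)) (enc_candidate (tagged xy)))
      (fun xy => enc_candidate (g (tag xy) (tagged xy)));
  ap_feasible :
    forall (x : instance P) (y : candidate (f x)),
      feasible y -> feasible (g x y);
  ap_approx :
    forall (R : realFieldType) (rho : R) (x : instance P)
      (y : candidate (f x)),
      approximate_solution rho y -> approximate_solution rho (g x y)
}.

Record graph := Graph {
  num_nodes : nat;
  edges : {set {set 'I_num_nodes}};
  edges_card2 : forall e, e \in edges -> #|e| = 2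
}.

Definition node (G : graph) : finType := 'I_(num_nodes G).

Definition adjacent (G : graph) : rel (node G) :=
  fun u v => [set u; v] \in edges G.

Definition independent (G : graph) (I : {set node G}) : bool :=
  [forall u in I, forall v in I, ~~ adjacent u v].

Definition is_tree (G : graph) : Prop :=
  [/\ 0 < num_nodes G,
      forall u v : node G, connect (@adjacent G) u v
    & forall c : seq (node G), ucycle (@adjacent G) c -> size c <= 2].

(* (s, f) stands for [s, f); the intervals of a list must satisfy
   s_1 < f_1 < s_2 < ... < s_k < f_k <= T, with k > 0. *)
Definition valid_intervals (T : nat) (l : seq (nat * nat)) : bool :=
  [&& l != [::],
      sorted ltn (flatten [seq [:: i.1; i.2] | i <- l])
    & all (fun i => i.2 <= T) l].

(* The value of intervals outside the edge set is irrelevant. *)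
Record temporal_graph := TemporalGraph {
  underlying : graph;
  lifetime : nat;
  intervals : {set node underlying} -> seq (nat * nat);
  intervals_valid :
    forall e, e \in edges underlying -> valid_intervals lifetime (intervals e)
}.

Definition exists_at (G : temporal_graph) (e : {set node (underlying G)})
    (t : nat) : bool :=
  has (fun i => i.1 <= t < i.2) (intervals e).

Definition overlap (G : temporal_graph) (e e' : {set node (underlying G)})
    : bool :=
  [&& e != e', e :&: e' != set0
    & [exists t : 'I_(lifetime G), exists_at e t && exists_at e' t]].

Definition timed_matching (G : temporal_graph)
    (M : {set {set node (underlying G)}}) : bool :=
  (M \subset edges (underlying G)) &&
  [forall e in M, forall e' in M, ~~ overlap e e'].

Record rooted_temporal_tree := RootedTemporalTree {
  tree :> temporal_graph;
  root_node : node (underlying tree);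
  treeP : is_tree (underlying tree)
}.

(* The edges {u, v}, as the pairs (u, v) with u < v in lexicographic order. *)
Definition edge_seq (n : nat) (E : {set {set 'I_n}}) : seq ('I_n * 'I_n) :=
  [seq p : 'I_n * 'I_n <- [seq (u, v) | u <- enum 'I_n, v <- enum 'I_n]
     | (p.1 < p.2) && ([set p.1; p.2] \in E)].

Definition enc_edge (n : nat) : 'I_n * 'I_n -> data :=
  enc_pair (@enc_ord n) (@enc_ord n).

Definition enc_node_set (G : graph) (A : {set node G}) : data :=
  enc_seq (@enc_ord (num_nodes G)) (enum A).

Definition enc_edge_set (G : graph) (E : {set {set node G}}) : data :=
  enc_seq (@enc_edge (num_nodes G)) (edge_seq E).

Definition enc_graph (G : graph) : data :=
  DCons (enc_node_set [set: node G]) (enc_edge_set (edges G)).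

Definition enc_rooted_temporal_tree (G : rooted_temporal_tree) : data :=
  DCons (enc_node_set [set: node (underlying G)])
 (DCons (enc_nat (lifetime G))
 (DCons (enc_ord (root_node G))
       (enc_seq
          (fun p => DCons (enc_edge p)
             (enc_seq (enc_pair enc_nat enc_nat)
                (@intervals G [set p.1; p.2])))
          (edge_seq (edges (underlying G)))))).

Definition MAX_IS : max_problem :=
  @MaxProblem graph (fun G => {set node G}) (@independent)
    (fun G I => #|I|) enc_graph (@enc_node_set).

Definition MAX_01_TMT_MULT : max_problem :=
  @MaxProblem rooted_temporal_tree
    (fun G => {set {set node (underlying G)}})
    (fun G => @timed_matching G)
    (fun G M => #|M|) enc_rooted_temporal_tree
    (fun G => @enc_edge_set (underlying G)).

(* Main.v *)
Require Import Defs.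
From HB Require Import structures.
From mathcomp Require Import all_boot all_order all_algebra zify.

Set Implicit Arguments.
Unset Strict Implicit.
Unset Printing Implicit Defensive.

(** The tree is a star. A graph with nodes 0, ..., n-1 is sent to the star with
    leaves 0, ..., n-1 and centre n, rooted at the centre; the edge {i, n} exists
    at one timestep reserved for i and at one timestep for each edge of the graph
    incident to i. All edges of a star share the centre, so {i, n} and {j, n}
    overlap exactly when i and j are adjacent: M |-> {i | {i, n} in M} is a
    cardinality-preserving bijection from 0-1 timed matchings to independent
    sets. Making the centre the last node keeps the lexicographic list of edges
    in the order of the leaves, so g only has to project a list of pairs, and f
    needs no arithmetic beyond a binary increment. *)

(** * Timed execution of WHILE programs *)

Lemma data_size_gt0 x : 0 < data_size x.
Proof. by case: x. Qed.

Lemma data_eqbP (x y : data) : reflect (x = y) (data_eqb x y).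
Proof.
apply: (iffP idP) => [|<-]; last by elim: x => //= x -> y' ->.
by elim: x y => [|x IHx y IHy] [|x' y'] //= /andP[/IHx -> /IHy ->].
Qed.

Lemma eq_eval s s' e : s =1 s' -> eval s e = eval s' e.
Proof.
move=> ss'; elim: e => //= [e1 -> e2 ->|e ->|e ->|e1 -> e2 ->] //.
Qed.

Lemma eq_eval_cost s s' e : s =1 s' -> eval_cost s e = eval_cost s' e.
Proof.
move=> ss'; elim: e => /= [i|| e1 -> e2 ->|e ->|e ->|e1 -> e2 ->] //;
  by rewrite ?ss' ?(eq_eval _ ss').
Qed.

Section Runs.

Variable B : nat.
Hypothesis B_gt0 : 0 < B.

Definition bounded (l : seq data) := all (fun x => data_size x <= B) l.

(** Coefficient of [B] in a bound on the size of the value of [e] when every register has size at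
    most [B]. A comparison gets 3, the size of [data_of_bool true], which is at most [3 * B] because
    [B] is positive. *)
Fixpoint size_weight (e : expr) : nat :=
  match e with
  | EVar _ | ENil => 1
  | ECons e1 e2 => (size_weight e1 + size_weight e2).+1
  | EHd e1 | ETl e1 => size_weight e1
  | EEq _ _ => 3
  end.

Fixpoint cost_weight (e : expr) : nat :=
  size_weight e +
  match e with
  | EVar _ | ENil => 0
  | ECons e1 e2 | EEq e1 e2 => cost_weight e1 + cost_weight e2
  | EHd e1 | ETl e1 => cost_weight e1
  end.

Lemma data_size_eval l e : bounded l ->
  data_size (eval (nth DNil l) e) <= size_weight e * B.
Proof.
move=> /all_nthP bl.
elim: e => [i||e1 IH1 e2 IH2|e IH|e IH|e1 IH1 e2 IH2] //=.
- rewrite mul1n; case: (ltnP i (size l)) => [/bl //|?]; by rewrite nth_default.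
- by rewrite mul1n.
- lia.
- by case: (eval _ e) IH => [|x y] /=; lia.
- by case: (eval _ e) IH => [|x y] /=; lia.
- by case: (data_eqb _ _) => /=; lia.
Qed.

Lemma eval_cost_weight l e : bounded l ->
  eval_cost (nth DNil l) e <= cost_weight e * B.
Proof.
move=> bl; have sz e' := data_size_eval e' bl.
elim: e => [i||e1 IH1 e2 IH2|e IH|e IH|e1 IH1 e2 IH2].
- by have:= sz (EVar i); rewrite /=; lia.
- by have:= sz ENil; rewrite /=; lia.
- by have:= sz (ECons e1 e2); rewrite /=; lia.
- by have:= sz (EHd e); rewrite /=; lia.
- by have:= sz (ETl e); rewrite /=; lia.
- by have:= sz (EEq e1 e2); rewrite /=; lia.
Qed.

(* A store is represented by the list of its first registers, the others
   being [DNil]; the time is counted in units of [B]. *)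
Definition runs (c : cmd) (l : seq data) (T : nat) (l' : seq data) : Prop :=
  forall s, s =1 nth DNil l ->
  exists t s', [/\ exec c s t s', t <= T * B & s' =1 nth DNil l'].

Lemma runs_le c l T T' l' : runs c l T l' -> T <= T' -> runs c l T' l'.
Proof.
move=> r TT' s /r[t [s' [ex tT s'l]]]; exists t, s'; split=> //.
by rewrite (leq_trans tT) // leq_mul2r TT' orbT.
Qed.

Lemma runs_assign i e l l' : bounded l ->
  set_nth DNil l i (eval (nth DNil l) e) = l' ->
  runs (CAssign i e) l (cost_weight e).+1 l'.
Proof.
move=> bl <- s sl; exists (eval_cost s e).+1, (update s i (eval s e)).
split; first exact: XAssign.
  by rewrite (eq_eval_cost _ sl); have := eval_cost_weight e bl; lia.
by move=> j; rewrite /update nth_set_nth /= (eq_eval _ sl) sl.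
Qed.

Lemma runs_seq c1 c2 l T1 l1 T2 l2 :
  runs c1 l T1 l1 -> runs c2 l1 T2 l2 ->
  runs (CSeq c1 c2) l (T1 + T2).+1 l2.
Proof.
move=> r1 r2 s /r1[t1 [s1 [e1 b1 /r2[t2 [s2 [e2 b2 s2l]]]]]].
exists (t1 + t2).+1, s2; split=> //; first exact: XSeq e1 e2.
lia.
Qed.

Lemma runs_if e c1 c2 l T l' : bounded l ->
  runs (if bool_of_data (eval (nth DNil l) e) then c1 else c2) l T l' ->
  runs (CIf e c1 c2) l (cost_weight e + T).+1 l'.
Proof.
move=> bl r s sl; have [t [s' [ex tT s'l]]] := r _ sl.
exists (eval_cost s e + t).+1, s'; split=> //; last first.
  by rewrite (eq_eval_cost _ sl); have := eval_cost_weight e bl; lia.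
move: ex; rewrite -(eq_eval _ sl).
case: ifP => b ex; first exact: XIfTrue.
by apply: XIfFalse; rewrite ?b.
Qed.

(** In place of an invariant, the loop follows an explicit sequence of register lists, [st i] being
    the state before round [i]. Each [st i] must be bounded because evaluating the guard is charged
    the sizes of what it reads; the last, failing guard is paid for separately. *)
Lemma runs_while e c (st : nat -> seq data) n T :
  (forall i, i <= n -> bounded (st i)) ->
  (forall i, i < n -> bool_of_data (eval (nth DNil (st i)) e)) ->
  ~~ bool_of_data (eval (nth DNil (st n)) e) ->
  (forall i, i < n -> runs c (st i) T (st i.+1)) ->
  runs (CWhile e c) (st 0) (n * (cost_weight e + T).+1 + (cost_weight e).+1)
    (st n).
Proof.
elim: n st => [|n IHn] st bst tst fst rst s sl.
  exists (eval_cost s e).+1, s; split=> //.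
    by apply: XWhileFalse; rewrite (eq_eval _ sl).
  by rewrite (eq_eval_cost _ sl); have := eval_cost_weight e (bst 0 isT); lia.
have [t1 [s1 [ex1 tT1 s1l]]] := rst 0 isT _ sl.
have [||||t2 [s2 [ex2 tT2 s2l]]] := IHn (st \o succn) _ _ _ _ s1 s1l.
- by move=> i i_n; apply: bst.
- by move=> i i_n; apply: tst.
- exact: fst.
- by move=> i i_n; apply: rst.
exists (eval_cost s e + t1 + t2).+1, s2; split=> //.
  by apply: XWhileTrue ex1 ex2; rewrite (eq_eval _ sl); apply: tst.
rewrite (eq_eval_cost _ sl); have := eval_cost_weight e (bst 0 isT); lia.
Qed.

End Runs.

(** * Binary numbers *)

Lemma enc_nat_double1 k : enc_nat k.*2.+1 = DCons (data_of_bool true) (enc_nat k).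
Proof.
rewrite /enc_nat.
(* Binary numbers are compared through the injective [nat_of_bin], where the claim becomes
   arithmetic, instead of through the algorithm of [bin_of_nat]. *)
have -> : bin_of_nat k.*2.+1 =
  if bin_of_nat k is BinNums.Npos p then BinNums.Npos (BinNums.xI p)
  else BinNums.Npos BinNums.xH.
  apply: (can_inj nat_of_binK); rewrite bin_of_natK.
  rewrite -{1}[k]bin_of_natK; case: (bin_of_nat k) => //= p.
  by rewrite NatTrec.doubleE.
by case: (bin_of_nat k).
Qed.

(** Zero is the empty list of bits, so prefixing a zero bit doubles only positive numbers. *)
Lemma enc_nat_double k : 0 < k ->
  enc_nat k.*2 = DCons (data_of_bool false) (enc_nat k).
Proof.
rewrite /enc_nat => k_gt0.
have : nat_of_bin (bin_of_nat k) = k by rewrite bin_of_natK.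
case: (bin_of_nat k) => [|p] def_k; first by rewrite -def_k in k_gt0.
suff -> : bin_of_nat k.*2 = BinNums.Npos (BinNums.xO p) by [].
apply: (can_inj nat_of_binK); rewrite bin_of_natK /=.
by rewrite NatTrec.doubleE -[in LHS]def_k.
Qed.

Lemma nat_half_ind (P : nat -> Prop) : P 0 ->
  (forall h, 0 < h -> P h -> P h.*2) -> (forall h, P h -> P h.*2.+1) ->
  forall k, P k.
Proof.
move=> P0 Pe Po; elim/ltn_ind=> -[//|k] IHk.
have {}IHk : P k.+1./2 by apply: IHk; lia.
rewrite -[k.+1]odd_double_half; case: (odd _); first exact: Po.
have [h0|/Pe] := posnP k.+1./2; first by rewrite h0.
exact.
Qed.

(** A linear bound, attained at 0 and 1, is enough: an encoded graph lists all its nodes, so its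
    size already exceeds their number. *)
Lemma data_size_enc_nat k : data_size (enc_nat k) <= 4 * k + 1.
Proof.
elim/nat_half_ind: k => // h; first by move=> h0; rewrite enc_nat_double //=; lia.
by rewrite enc_nat_double1 /=; lia.
Qed.

Lemma enc_nat_inj : injective enc_nat.
Proof.
have pos_inj : injective enc_pos.
  elim=> [p IHp|p IHp|] [q|q|] //= [].
  - by move=> /IHp ->.
  - by case: p {IHp}.
  - by move=> /IHp ->.
  - by case: q.
move=> i j; rewrite /enc_nat => e.
apply: (can_inj bin_of_natK); move: e.
case: (bin_of_nat i) (bin_of_nat j) => [|p] [|q] //.
- by case: q.
- by case: p.
- by move=> /pos_inj ->.
Qed.

Lemma data_eqb_enc_nat i j : data_eqb (enc_nat i) (enc_nat j) = (i == j).
Proof. by apply/data_eqbP/eqP => [/enc_nat_inj|->]. Qed.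

Local Notation dtrue := (DCons DNil DNil).
Local Notation etrue := (ECons ENil ENil).

(** Carry propagation: [j] is the number of trailing ones of [k], and [y] is either empty or starts
    with a zero bit. Since [data_hd] and [data_tl] send [DNil] to [DNil], one formula covers both
    cases. *)
Lemma enc_nat_carry k : exists j y, [/\ j <= k,
  enc_nat k = iter j (DCons dtrue) y, data_hd y = DNil
  & enc_nat k.+1 = iter j (DCons DNil) (DCons dtrue (data_tl y))].
Proof.
elim/nat_half_ind: k => [|h h0 _|h [j [y [jh Ek hy EkS]]]].
- by exists 0, DNil.
- exists 0, (enc_nat h.*2); split=> //; first by rewrite enc_nat_double.
  by rewrite enc_nat_double1 enc_nat_double.
- exists j.+1, y; split=> //; first lia.
    by rewrite enc_nat_double1 Ek.
  by rewrite -doubleS enc_nat_double // EkS.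
Qed.

Lemma data_size_iter j x y :
  data_size (iter j (DCons x) y) = j * (data_size x).+1 + data_size y.
Proof. by elim: j => //= j ->; lia. Qed.

(* Ripple-carry increment of register 3: the leading ones are moved to
   register 6 as zeros and then put back. *)
Definition inc : cmd :=
  CSeq (CWhile (EHd (EVar 3))
         (CSeq (CAssign 6 (ECons ENil (EVar 6))) (CAssign 3 (ETl (EVar 3)))))
 (CSeq (CAssign 3 (ECons etrue (ETl (EVar 3))))
       (CWhile (EVar 6)
         (CSeq (CAssign 3 (ECons ENil (EVar 3))) (CAssign 6 (ETl (EVar 6)))))).

Lemma runs_inc B k x0 x1 x2 x4 x5 r :
  4 * k + 5 <= B -> bounded B [:: x0, x1, x2, x4, x5 & r] ->
  runs B inc [:: x0, x1, x2, enc_nat k, x4, x5, DNil & r] (30 * k.+1)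
    [:: x0, x1, x2, enc_nat k.+1, x4, x5, DNil & r].
Proof.
move=> kB /and5P[b0 b1 b2 b4 /andP[b5 br]].
have [j [y [jk Ek hy EkS]]] := enc_nat_carry k.
have := data_size_enc_nat k; have := data_size_enc_nat k.+1.
rewrite EkS Ek !data_size_iter /= => sz1 sz2.
have B0 : 0 < B by lia.
(* After [i] rounds of the first loop, [j - i] trailing ones remain and [i] zeros wait in register
   6; [st2] describes the way back. *)
pose st1 i := [:: x0, x1, x2, iter (j - i) (DCons dtrue) y, x4, x5,
                 iter i (DCons DNil) DNil & r].
pose st2 i := [:: x0, x1, x2, iter i (DCons DNil) (DCons dtrue (data_tl y)),
                 x4, x5, iter (j - i) (DCons DNil) DNil & r].
have bst1 i : i <= j -> bounded B (st1 i).
  move=> ij; rewrite /= b0 b1 b2 b4 b5 /= !data_size_iter.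
  by apply/and3P; split=> //=; lia.
have bst2 i : i <= j -> bounded B (st2 i).
  move=> ij; rewrite /= b0 b1 b2 b4 b5 /= !data_size_iter.
  by apply/and3P; split=> //=; lia.
apply: runs_le; first apply: (runs_seq B0).
- have -> : [:: x0, x1, x2, iter j (DCons dtrue) y, x4, x5, DNil & r] = st1 0.
    by rewrite /st1 subn0.
  apply: (runs_while B0 (n := j)) => //.
  + by move=> i ij; rewrite /st1 /= -subSS subSn.
  + by rewrite /st1 /= subnn /= hy.
  + move=> i ij; apply: (runs_seq B0); apply: (runs_assign B0) => //=.
    * exact: bst1 (ltnW ij).
    * rewrite b0 b1 b2 b4 b5 /= !data_size_iter.
      by apply/and3P; split=> //=; lia.
    * by rewrite /st1 /= -subSS subSn.
- apply: (runs_seq B0); first by apply: (runs_assign B0) => //; exact: bst1.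
  rewrite /st1 subnn /=.
  have -> : [:: x0, x1, x2, DCons dtrue (data_tl y), x4, x5,
               iter j (DCons DNil) DNil & r] = st2 0.
    by rewrite /st2 subn0.
  have -> : [:: x0, x1, x2, iter j (DCons DNil) (DCons dtrue (data_tl y)), x4,
               x5, DNil & r] = st2 j by rewrite /st2 subnn.
  apply: (runs_while B0 (n := j)) => //.
  + by move=> i ij; rewrite /st2 /= -subSS subSn.
  + by rewrite /st2 /= subnn.
  + move=> i ij; apply: (runs_seq B0); apply: (runs_assign B0) => //=.
    * exact: bst2 (ltnW ij).
    * rewrite b0 b1 b2 b4 b5 /= !data_size_iter.
      by apply/and3P; split=> //=; lia.
    * by rewrite /st2 /= -subSS subSn.
- rewrite /=; lia.
Qed.

(** * The program computing the star *)

Lemma data_size_enc_seq (T : eqType) (enc : T -> data) (l : seq T) M :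
  {in l, forall x, data_size (enc x) <= M} ->
  data_size (enc_seq enc l) <= size l * M.+1 + 1.
Proof.
elim: l => //= x l IHl lM.
have := lM x (mem_head _ _).
have : data_size (enc_seq enc l) <= size l * M.+1 + 1.
  by apply: IHl => y yl; apply: lM; rewrite in_cons yl orbT.
rewrite /=; lia.
Qed.

Lemma size_enc_seq (T : Type) (enc : T -> data) (l : seq T) :
  size l < data_size (enc_seq enc l).
Proof.
by elim: l => //= x l IHl; have := data_size_gt0 (enc x); lia.
Qed.

Local Notation enc_nats := (enc_seq enc_nat).
Local Notation enc_np := (enc_pair enc_nat enc_nat).
Local Notation enc_slots := (enc_seq (enc_pair enc_np enc_nat)).

(* The item at position k of [items n E] owns the timestep 4k+2; the items
   (i, i) only serve to give each leaf a nonempty list of intervals. *)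
Definition items (n : nat) (E : seq (nat * nat)) : seq (nat * nat) :=
  [seq (i, i) | i <- iota 0 n] ++ E.

Definition slots (n : nat) (E : seq (nat * nat)) : seq (nat * nat * nat) :=
  zip (items n E) (iota 0 (n + size E)).

(* These two numbers are, in binary, k followed by the bits 10 and 11. *)
Definition slot_interval (k : nat) : nat * nat :=
  (k.*2.+1.*2, k.*2.+1.*2.+1).

Definition hits (i : nat) (p : nat * nat * nat) : bool :=
  (p.1.1 == i) || (p.1.2 == i).

Definition leaf_intervals n E (i : nat) : seq (nat * nat) :=
  [seq slot_interval p.2 | p <- slots n E & hits i p].

(** The start of the first slot past the last one: it exceeds every interval in use, and its
    encoding is that of [K] with two bits prefixed, even for [K = 0]. *)
Definition star_lifetime (K : nat) : nat := K.*2.+1.*2.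

(** The expected output in terms of lists of numbers only, so that the analysis of the program
    involves no graphs; [enc_star_tree] links it to the encoding of the tree. *)
Definition enc_star (n : nat) (E : seq (nat * nat)) : data :=
  DCons (enc_nats (iota 0 n.+1))
 (DCons (enc_nat (star_lifetime (n + size E)))
 (DCons (enc_nat n)
        (enc_seq (fun i => DCons (enc_np (i, n))
                             (enc_seq enc_np (leaf_intervals n E i)))
                 (iota 0 n)))).

Lemma size_items n E : size (items n E) = n + size E.
Proof. by rewrite size_cat size_map size_iota. Qed.

Lemma size_slots n E : size (slots n E) = n + size E.
Proof. by rewrite size_zip size_items size_iota minnn. Qed.

Lemma take_slotsS n E j : j < n + size E ->
  take j.+1 (slots n E) = rcons (take j (slots n E)) (nth (0, 0) (items n E) j, j).
Proof.
move=> jK; rewrite (take_nth ((0, 0), 0)) ?size_slots // nth_zip.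
  by rewrite nth_iota.
by rewrite size_items size_iota.
Qed.

Lemma mem_slots n E p k : (p, k) \in slots n E ->
  k < n + size E /\ p = nth (0, 0) (items n E) k.
Proof.
move=> /(nthP ((0, 0), 0))[j]; rewrite size_slots => jK.
rewrite nth_zip ?size_items ?size_iota //= nth_iota // add0n.
by case=> <- <-.
Qed.

Lemma slots_lt n (E : seq (nat * nat)) (p : nat * nat * nat) :
  {in E, forall e : nat * nat, (e.1 < n) && (e.2 < n)} ->
  p \in slots n E -> [&& p.1.1 < n, p.1.2 < n & p.2 < n + size E].
Proof.
move=> En; case: p => p k /mem_slots[kK ->] /=; rewrite kK andbT.
have : nth (0, 0) (items n E) k \in items n E by rewrite mem_nth // size_items.
rewrite mem_cat => /orP[/mapP[i]|/En //].
by rewrite mem_iota /= => i_n -> /=; rewrite i_n.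
Qed.

(** The language has no disjunction: neither endpoint is the current leaf exactly when the pair of
    comparison results is [ECons ENil ENil], and then register 8 is left alone. The ends of the
    interval are built by prefixing two bits to the slot number. *)
Definition collect_body : cmd :=
  CSeq (CIf (EEq (ECons (EEq (EHd (EHd (EHd (EVar 7)))) (EHd (EVar 2)))
                        (EEq (ETl (EHd (EHd (EVar 7)))) (EHd (EVar 2))))
                 (ECons ENil ENil))
         (CAssign 8 (EVar 8))
         (CAssign 8
           (ECons (ECons (ECons ENil (ECons etrue (ETl (EHd (EVar 7)))))
                         (ECons etrue (ECons etrue (ETl (EHd (EVar 7))))))
                  (EVar 8))))
       (CAssign 7 (ETl (EVar 7))).

Definition collect : cmd := CWhile (EVar 7) collect_body.

Definition nodes_body : cmd :=
  CSeq (CAssign 2 (ECons (EHd (EVar 1)) (EVar 2)))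
 (CSeq (CAssign 4 (ECons (ECons (ECons (EHd (EVar 1)) (EHd (EVar 1))) (EVar 3))
                         (EVar 4)))
 (CSeq inc (CAssign 1 (ETl (EVar 1))))).

Definition edges_body : cmd :=
  CSeq (CAssign 4 (ECons (ECons (EHd (EVar 1)) (EVar 3)) (EVar 4)))
 (CSeq inc (CAssign 1 (ETl (EVar 1)))).

(** The slots are copied first because [collect] consumes them. They are stored in reverse, so
    prepending the intervals found puts these in increasing order. *)
Definition leaves_body : cmd :=
  CSeq (CAssign 7 (EVar 4))
 (CSeq collect
 (CSeq (CAssign 9 (ECons (ECons (ECons (EHd (EVar 2)) (EVar 5)) (EVar 8))
                         (EVar 9)))
 (CSeq (CAssign 10 (ECons (EHd (EVar 2)) (EVar 10)))
 (CSeq (CAssign 8 ENil) (CAssign 2 (ETl (EVar 2))))))).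

(* Registers: 1 the nodes or edges left, 2 the nodes in reverse, 3 the counter,
   4 the slots in reverse, 5 the centre, 6 scratch of [inc], 7 the slots left,
   8 the intervals of the current leaf, 9 the output edges, 10 the output
   nodes. *)
Definition star_program : cmd :=
  CSeq (CAssign 1 (EHd (EVar 0)))
 (CSeq (CWhile (EVar 1) nodes_body)
 (CSeq (CAssign 5 (EVar 3))
 (CSeq (CAssign 1 (ETl (EVar 0)))
 (CSeq (CWhile (EVar 1) edges_body)
 (CSeq (CAssign 10 (ECons (EVar 5) ENil))
 (CSeq (CWhile (EVar 2) leaves_body)
       (CAssign 0 (ECons (EVar 10)
                  (ECons (ECons ENil (ECons etrue (EVar 3)))
                  (ECons (EVar 5) (EVar 9))))))))))).

Ltac solve_bounds :=
  move=> *; rewrite /bounded /=; do ?[apply/andP; split]; rewrite //=; lia.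

(** * Output and running time of the star program *)

Section StarProgram.

Variables (n : nat) (E : seq (nat * nat)) (N : nat).
Hypothesis E_lt : {in E, forall e : nat * nat, (e.1 < n) && (e.2 < n)}.
Hypothesis nEN : n + size E < N.

(** Cubic because of the list of output edges: at most [N] entries, each carrying a list of
    intervals of size [O(N^2)]. The factor 10 in [B] is slack. *)
Let b := 100 * N ^ 3.
Let B := 10 * b.

Let N_gt0 : 0 < N. Proof. by lia. Qed.

Let N_le_b : 100 * N <= b.
Proof. by rewrite leq_mul2l /= -[leqLHS]expn1 leq_pexp2l. Qed.

Let b_gt0 : 0 < b. Proof. by have := N_le_b; lia. Qed.
Let B0 : 0 < B. Proof. by rewrite muln_gt0. Qed.

Let bE : 100 * (N * (N * N)) <= b.
Proof. by rewrite /b !expnS muln1. Qed.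

(** The allowance [25 * N] is set by the largest items stored in such lists, the encoded slot
    intervals. *)
Lemma small_list (T : eqType) (enc : T -> data) (l : seq T) :
  {in l, forall x, data_size (enc x) <= 25 * N} -> size l <= N ->
  data_size (enc_seq enc l) <= 30 * (N * N).
Proof.
move=> /data_size_enc_seq sz lN; apply: leq_trans sz _.
apply: leq_trans (_ : N * (25 * N).+1 + 1 <= _); last by nia.
by rewrite leq_add2r leq_mul2r lN orbT.
Qed.

Lemma small_list_le_b : 30 * (N * N) <= b.
Proof. by apply: leq_trans bE; nia. Qed.

Lemma enc_nat_small k : k <= N -> data_size (enc_nat k) <= 5 * N.
Proof. by move=> kN; apply: leq_trans (data_size_enc_nat k) _; lia. Qed.

Lemma enc_np_small (e : nat * nat) : e.1 < n -> e.2 < n -> data_size (enc_np e) <= 11 * N.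
Proof.
move=> e1 e2; rewrite /=.
have := @enc_nat_small e.1; have := @enc_nat_small e.2; lia.
Qed.

Lemma enc_slot_small (p : nat * nat * nat) : p \in slots n E ->
  data_size (enc_pair enc_np enc_nat p) <= 17 * N.
Proof.
move=> /(slots_lt E_lt)/and3P[p1 p2 pk]; rewrite /=.
have := enc_np_small p1 p2; have := @enc_nat_small p.2; rewrite /=; lia.
Qed.

Lemma enc_slot_intervalE k : enc_np (slot_interval k) =
  DCons (DCons DNil (DCons dtrue (enc_nat k)))
        (DCons dtrue (DCons dtrue (enc_nat k))).
Proof. by rewrite /enc_pair /= enc_nat_double // !enc_nat_double1. Qed.

Lemma enc_slot_interval_small k : k <= N ->
  data_size (enc_np (slot_interval k)) <= 25 * N.
Proof.
rewrite enc_slot_intervalE /= => /enc_nat_small; lia.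
Qed.

Lemma slots_small (l : seq (nat * nat * nat)) : {subset l <= slots n E} -> size l <= N ->
  data_size (enc_slots l) <= b.
Proof.
move=> ls lN; apply: leq_trans small_list_le_b; apply: small_list => // p /ls.
by move=> /enc_slot_small; lia.
Qed.

Lemma intervals_small (l : seq (nat * nat * nat)) i :
  {subset l <= slots n E} -> size l <= N ->
  data_size (enc_seq enc_np (rev [seq slot_interval p.2 | p <- l & hits i p]))
  <= 30 * (N * N).
Proof.
move=> ls lN; apply: small_list => [e|]; last first.
  by rewrite size_rev size_map size_filter (leq_trans (count_size _ _)).
rewrite mem_rev => /mapP[p]; rewrite mem_filter => /andP[_ /ls].
by move=> /(slots_lt E_lt)/and3P[_ _ pk] ->; apply: enc_slot_interval_small; lia.
Qed.

Lemma nats_small (l : seq nat) : {in l, forall i, i <= N} -> size l <= N ->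
  data_size (enc_nats l) <= b.
Proof.
move=> ls lN; apply: leq_trans small_list_le_b; apply: small_list => // p /ls.
by move=> /enc_nat_small; lia.
Qed.

(** Used with [l] the reversed list of slots, so that the reversal in register 8 cancels and leaves
    [leaf_intervals]. *)
Lemma runs_collect (i : nat) (l : seq (nat * nat * nat)) x0 x1 w x3 x4 x5 x6 x9 x10 :
  {subset l <= slots n E} -> size l <= N ->
  bounded B [:: x0; x1; DCons (enc_nat i) w; x3; x4; x5; x6; x9; x10] ->
  runs B collect
    [:: x0; x1; DCons (enc_nat i) w; x3; x4; x5; x6; enc_slots l; DNil; x9; x10]
    (200 * N)
    [:: x0; x1; DCons (enc_nat i) w; x3; x4; x5; x6; DNil;
      enc_seq enc_np (rev [seq slot_interval p.2 | p <- l & hits i p]); x9; x10].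
Proof.
move=> ls lN /and5P[c0 c1 c2 c3 /and5P[c4 c5 c6 c9 /andP[c10 _]]].
pose st j := [:: x0; x1; DCons (enc_nat i) w; x3; x4; x5; x6;
  enc_slots (drop j l);
  enc_seq enc_np (rev [seq slot_interval p.2 | p <- take j l & hits i p]);
  x9; x10].
have drop_b j : data_size (enc_slots (drop j l)) <= b.
  apply: slots_small => [p /mem_drop /ls //|]; rewrite size_drop; lia.
have take_b j : data_size (enc_seq enc_np
    (rev [seq slot_interval p.2 | p <- take j l & hits i p])) <= b.
  apply: leq_trans small_list_le_b; apply: intervals_small => [p /mem_take /ls //|].
  by rewrite (leq_trans _ lN) // size_take; case: ltnP => //; lia.
have b_B : b <= B by rewrite /B; lia.
have bst j : bounded B (st j).
  by rewrite /st /bounded /all c0 c1 c2 c3 c4 c5 c6 c9 c10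
    (leq_trans (drop_b j)) ?(leq_trans (take_b j)).
have -> : [:: x0; x1; DCons (enc_nat i) w; x3; x4; x5; x6; enc_slots l; DNil;
             x9; x10] = st 0 by rewrite /st drop0 take0.
have -> : [:: x0; x1; DCons (enc_nat i) w; x3; x4; x5; x6; DNil;
      enc_seq enc_np (rev [seq slot_interval p.2 | p <- l & hits i p]); x9; x10]
   = st (size l) by rewrite /st drop_size take_size.
apply: runs_le; first apply: (runs_while B0 (n := size l)) => [j _||| j jl].
- exact: bst.
- by move=> j jl; rewrite /st (drop_nth ((0, 0), 0)).
- by rewrite /st drop_size.
- have tl_b := take_b j.+1; have := bst j.
  move: (drop_b j) (drop_b j.+1) tl_b.
  rewrite /st (take_nth ((0, 0), 0)) // filter_rcons.
  rewrite (drop_nth ((0, 0), 0)) //; set p := nth _ _ _; set d := drop _ _.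
  set l' := if _ then _ else _; set acc := enc_seq _ (rev (map _ l')).
  rewrite [enc_slots (_ :: _)]/=; move=> d1 d2 acc_b bj.
  apply: (runs_seq B0 (l1 := [:: x0; x1; DCons (enc_nat i) w; x3; x4; x5; x6;
    DCons (enc_pair enc_np enc_nat p) (enc_slots d); acc; x9; x10])).
    apply: (runs_if B0 (T := 100)) => //.
    rewrite /= !data_eqb_enc_nat.
    have -> : data_eqb (data_of_bool (p.1.1 == i)) DNil
              && data_eqb (data_of_bool (p.1.2 == i)) DNil = ~~ hits i p.
      by rewrite /hits; case: (p.1.1 == i) (p.1.2 == i) => [] [].
    rewrite /acc /l'; case: (hits i p) => /=; apply: runs_le;
      first [apply: (runs_assign B0) => //= | by []].
    by rewrite map_rcons rev_rcons [in RHS]/= enc_slot_intervalE.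
  apply: (runs_assign B0) => //.
  rewrite /bounded /all c0 c1 c2 c3 c4 c5 c6 c9 c10.
  by rewrite (leq_trans d1) ?(leq_trans acc_b).
- rewrite /=; lia.
Qed.

Let BE : B = 10 * b. Proof. by []. Qed.

Let iota_lt (m k : nat) : m + k <= N -> data_size (enc_nats (iota m k)) <= b.
Proof.
move=> mkN; apply: nats_small => [i|]; rewrite ?size_iota ?mem_iota; lia.
Qed.

Let rev_iota_lt (m k : nat) :
  m + k <= N -> data_size (enc_nats (rev (iota m k))) <= b.
Proof.
move=> mkN; apply: nats_small => [i|]; rewrite ?size_rev ?size_iota //; last lia.
by rewrite mem_rev mem_iota; lia.
Qed.

Let slots_take_small j : data_size (enc_slots (rev (take j (slots n E)))) <= b.
Proof.
apply: slots_small => [p|]; first by rewrite mem_rev => /mem_take.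
by rewrite size_rev size_take size_slots; case: ltnP; lia.
Qed.

Lemma runs_nodes x0 : data_size x0 <= b ->
  runs B (CWhile (EVar 1) nodes_body)
    [:: x0; enc_nats (iota 0 n); DNil; DNil; DNil; DNil;
        DNil; DNil; DNil; DNil; DNil]
    (100 * (N * N))
    [:: x0; DNil; enc_nats (rev (iota 0 n)); enc_nat n;
        enc_slots (rev (take n (slots n E))); DNil;
        DNil; DNil; DNil; DNil; DNil].
Proof.
move=> x0b.
pose st j := [:: x0; enc_nats (iota j (n - j)); enc_nats (rev (iota 0 j));
  enc_nat j; enc_slots (rev (take j (slots n E))); DNil;
  DNil; DNil; DNil; DNil; DNil].
have -> : [:: x0; enc_nats (iota 0 n); DNil; DNil; DNil; DNil;
  DNil; DNil; DNil; DNil; DNil] = st 0 by rewrite /st take0 subn0.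
have -> : [:: x0; DNil; enc_nats (rev (iota 0 n)); enc_nat n;
  enc_slots (rev (take n (slots n E))); DNil;
  DNil; DNil; DNil; DNil; DNil] = st n by rewrite /st subnn.
have st_split j : j < n -> iota j (n - j) = j :: iota j.+1 (n - j.+1).
  by move=> jn; rewrite -subSS subSn.
(* Incrementing the counter takes at most [30 * N], as the counter stays below [N]; the constant
   covers the assignments. *)
apply: runs_le; first apply: (runs_while B0 (n := n) (T := 30 * N + 60)).
- move=> j jn; have := @iota_lt j (n - j); have := @rev_iota_lt 0 j.
  have := slots_take_small j; have := @enc_nat_small j; solve_bounds.
- by move=> j jn; rewrite /st st_split.
- by rewrite /st subnn.
- move=> j jn.
  have := @iota_lt j (n - j); have := @rev_iota_lt 0 j.
  have := slots_take_small j; have := @enc_nat_small j.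
  have := slots_take_small j.+1; have := @rev_iota_lt 0 j.+1.
  have -> : rev (iota 0 j.+1) = j :: rev (iota 0 j).
    by rewrite -addn1 iotaD rev_cat.
  rewrite /st take_slotsS ?rev_rcons; last lia.
  have -> : nth (0, 0) (items n E) j = (j, j).
    by rewrite nth_cat size_map size_iota jn (nth_map 0) ?size_iota ?nth_iota.
  have -> : rev (iota 0 j.+1) = j :: rev (iota 0 j).
    by rewrite -addn1 iotaD rev_cat.
  rewrite st_split //= => h1 h2 h3 h4 h5 h6.
  apply: runs_le; first apply: (runs_seq B0).
  + by apply: (runs_assign B0) => //=; solve_bounds.
  + apply: (runs_seq B0); first by apply: (runs_assign B0) => //=; solve_bounds.
    apply: (runs_seq B0).
      by apply: runs_inc; [lia | solve_bounds].
    have := @enc_nat_small j.+1.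
    by move=> h7; apply: (runs_assign B0) => //=; solve_bounds.
  + rewrite /=; lia.
- by rewrite /=; nia.
Qed.

Lemma runs_edges x0 x2 : data_size x0 <= b -> data_size x2 <= b ->
  runs B (CWhile (EVar 1) edges_body)
    [:: x0; enc_seq enc_np E; x2; enc_nat n;
        enc_slots (rev (take n (slots n E))); enc_nat n;
        DNil; DNil; DNil; DNil; DNil]
    (100 * (N * N))
    [:: x0; DNil; x2; enc_nat (n + size E);
        enc_slots (rev (slots n E)); enc_nat n;
        DNil; DNil; DNil; DNil; DNil].
Proof.
move=> x0b x2b.
pose st j := [:: x0; enc_seq enc_np (drop j E); x2; enc_nat (n + j);
  enc_slots (rev (take (n + j) (slots n E))); enc_nat n;
  DNil; DNil; DNil; DNil; DNil].
have -> : [:: x0; enc_seq enc_np E; x2; enc_nat n;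
  enc_slots (rev (take n (slots n E))); enc_nat n;
  DNil; DNil; DNil; DNil; DNil] = st 0 by rewrite /st drop0 addn0.
have -> : [:: x0; DNil; x2; enc_nat (n + size E);
  enc_slots (rev (slots n E)); enc_nat n;
  DNil; DNil; DNil; DNil; DNil] = st (size E).
  by rewrite /st drop_size take_oversize ?size_slots.
have E_b j : data_size (enc_seq enc_np (drop j E)) <= b.
  apply: leq_trans small_list_le_b; apply: small_list => [e /mem_drop/E_lt|].
    by move=> /andP[e1 e2]; have := enc_np_small e1 e2; lia.
  by rewrite size_drop (leq_trans (leq_subr _ _)) // ltnW // (leq_ltn_trans (leq_addl n _)).
have := @enc_nat_small n => n_b.
apply: runs_le; first apply: (runs_while B0 (n := size E) (T := 30 * N + 60)).
- move=> j jE; have := E_b j; have := slots_take_small (n + j).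
  have := @enc_nat_small (n + j); solve_bounds.
- by move=> j jE; rewrite /st (drop_nth (0, 0)).
- by rewrite /st drop_size.
- move=> j jE.
  have := E_b j; have := slots_take_small (n + j).
  have := @enc_nat_small (n + j); have := slots_take_small (n + j.+1).
  rewrite /st addnS take_slotsS ?rev_rcons; last lia.
  rewrite (drop_nth (0, 0)) //=.
  have -> : nth (0, 0) (items n E) (n + j) = nth (0, 0) E j.
    by rewrite nth_cat size_map size_iota -ltn_subRL subnn addKn.
  move=> h1 h2 h3 h4.
  apply: runs_le; first apply: (runs_seq B0).
  + by apply: (runs_assign B0) => //=; solve_bounds.
  + apply: (runs_seq B0).
      by apply: runs_inc; [lia | solve_bounds].
    have := @enc_nat_small (n + j).+1.
    by move=> h7; apply: (runs_assign B0) => //=; solve_bounds.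
  + rewrite /=; lia.
- by rewrite /=; nia.
Qed.

Let enc_leaf i := DCons (enc_np (i, n)) (enc_seq enc_np (leaf_intervals n E i)).

Let leaf_intervals_small i :
  data_size (enc_seq enc_np (leaf_intervals n E i)) <= 30 * (N * N).
Proof.
have := @intervals_small (rev (slots n E)) i.
rewrite filter_rev map_rev revK size_rev size_slots; apply; last lia.
by move=> p; rewrite mem_rev.
Qed.

Let leaves_small (l : seq nat) : {in l, forall i, i < n} -> size l <= n ->
  data_size (enc_seq enc_leaf l) <= b.
Proof.
move=> l_lt ln; apply: leq_trans (data_size_enc_seq (M := 50 * (N * N)) _) _.
  move=> i /l_lt i_n; have := leaf_intervals_small i.
  have := @enc_nat_small i; have := @enc_nat_small n; rewrite /=.
  by move=> /(_ ltac:(lia)) h1 /(_ ltac:(lia)) h2 h3; nia.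
apply: leq_trans bE; apply: leq_trans (_ : N * (50 * (N * N)).+1 + 1 <= _).
  by rewrite leq_add2r leq_mul // (leq_trans ln) //; lia.
by nia.
Qed.

(** Leaves are treated from last to first, so prepending produces increasing lists, and the centre,
    already in register 10, ends up as the last node. *)
Lemma runs_leaves x0 : data_size x0 <= b ->
  runs B (CWhile (EVar 2) leaves_body)
    [:: x0; DNil; enc_nats (rev (iota 0 n)); enc_nat (n + size E);
        enc_slots (rev (slots n E)); enc_nat n;
        DNil; DNil; DNil; DNil; DCons (enc_nat n) DNil]
    (300 * (N * N))
    [:: x0; DNil; DNil; enc_nat (n + size E);
        enc_slots (rev (slots n E)); enc_nat n;
        DNil; DNil; DNil; enc_seq enc_leaf (iota 0 n); enc_nats (iota 0 n.+1)].
Proof.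
move=> x0b; set l := rev (iota 0 n).
have sl : size l = n by rewrite size_rev size_iota.
have l_lt : {in l, forall i, i < n} by move=> i; rewrite mem_rev mem_iota.
pose st j := [:: x0; DNil; enc_nats (drop j l); enc_nat (n + size E);
  enc_slots (rev (slots n E)); enc_nat n; DNil; DNil; DNil;
  enc_seq enc_leaf (rev (take j l)); enc_nats (rcons (rev (take j l)) n)].
have -> : [:: x0; DNil; enc_nats l; enc_nat (n + size E);
  enc_slots (rev (slots n E)); enc_nat n;
  DNil; DNil; DNil; DNil; DCons (enc_nat n) DNil] = st 0.
  by rewrite /st drop0 take0.
have -> : [:: x0; DNil; DNil; enc_nat (n + size E);
  enc_slots (rev (slots n E)); enc_nat n;
  DNil; DNil; DNil; enc_seq enc_leaf (iota 0 n); enc_nats (iota 0 n.+1)] = st n.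
  rewrite /st -[X in drop X]sl -[X in take X]sl drop_size take_size revK.
  by rewrite -addn1 iotaD cats1.
have R2b j : data_size (enc_nats (drop j l)) <= b.
  apply: nats_small => [i /mem_drop/l_lt|]; rewrite ?size_drop; lia.
have size_take j : size (take j l) <= n.
  by rewrite size_take sl; case: ltnP; lia.
have R9b j : data_size (enc_seq enc_leaf (rev (take j l))) <= b.
  apply: leaves_small => [i|]; last by rewrite size_rev.
  by rewrite mem_rev => /mem_take/l_lt.
have R10b j : data_size (enc_nats (rcons (rev (take j l)) n)) <= b.
  apply: nats_small => [i|]; last first.
    by rewrite size_rcons size_rev; have := size_take j; lia.
  rewrite mem_rcons in_cons mem_rev => /orP[/eqP ->|/mem_take/l_lt]; lia.
have := slots_take_small (n + size E); rewrite take_oversize ?size_slots // => R4b.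
have := @enc_nat_small n => /(_ ltac:(lia)) n_b.
have := @enc_nat_small (n + size E) => /(_ ltac:(lia)) K_b.
apply: runs_le; first apply: (runs_while B0 (n := n) (T := 200 * N + 60)).
- move=> j jn; have := R2b j; have := R9b j; have := R10b j; solve_bounds.
- by move=> j jn; rewrite /st (drop_nth 0) ?sl.
- by rewrite /st -{1}sl drop_size.
- move=> j jn.
  have := R2b j; have := R9b j; have := R10b j.
  have := R2b j.+1; have := R9b j.+1; have := R10b j.+1.
  have -> : drop j l = nth 0 l j :: drop j.+1 l by rewrite (drop_nth 0) ?sl.
  rewrite /st (take_nth 0) ?sl // rev_rcons (drop_nth 0 (_ : j < size l)) ?sl //=.
  set i := nth 0 l j; set d := enc_nats (drop _ _).
  move=> h1 h2 h3 h4 h5 h6; have := leaf_intervals_small i => h7.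
  have {}h7 := leq_trans h7 small_list_le_b.
  apply: runs_le; first apply: (runs_seq B0).
  + by apply: (runs_assign B0) => //=; solve_bounds.
  + apply: (runs_seq B0).
      apply: runs_collect.
      * by move=> p; rewrite mem_rev.
      * by rewrite size_rev size_slots; lia.
      * solve_bounds.
    rewrite filter_rev map_rev revK -/(leaf_intervals n E i).
    apply: (runs_seq B0); first by apply: (runs_assign B0) => //=; solve_bounds.
    apply: (runs_seq B0); first by apply: (runs_assign B0) => //=; solve_bounds.
    apply: (runs_seq B0); first by apply: (runs_assign B0) => //=; solve_bounds.
    by apply: (runs_assign B0) => //=; solve_bounds.
  + rewrite /=; lia.
- by rewrite /=; nia.
Qed.

Lemma runs_star_program :
  let x := DCons (enc_nats (iota 0 n)) (enc_seq enc_np E) in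
  data_size x <= N -> exists l,
  runs B star_program [:: x; DNil; DNil; DNil; DNil; DNil;
        DNil; DNil; DNil; DNil; DNil] (600 * (N * N)) (enc_star n E :: l).
Proof.
move=> x xN.
have xb : data_size x <= b by lia.
have xb' : (data_size (enc_nats (iota 0 n))
            + data_size (enc_seq enc_np E)).+1 <= b := xb.
have := @enc_nat_small n => /(_ ltac:(lia)) n_b.
have := @enc_nat_small (n + size E) => /(_ ltac:(lia)) K_b.
have R2b := @rev_iota_lt 0 n ltac:(lia).
have R10b := @iota_lt 0 n.+1 ltac:(lia).
have := slots_take_small (n + size E); rewrite take_oversize ?size_slots // => R4b.
have R4b' := slots_take_small n.
have R9b : data_size (enc_seq enc_leaf (iota 0 n)) <= b.
  by apply: leaves_small => [i|]; rewrite ?mem_iota ?size_iota.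
have lifeE : enc_nat (star_lifetime (n + size E)) =
  DCons DNil (DCons dtrue (enc_nat (n + size E))).
  by rewrite enc_nat_double // enc_nat_double1.
eexists; apply: runs_le; first apply: (runs_seq B0).
- by apply: (runs_assign B0) => //=; solve_bounds.
- apply: (runs_seq B0); first exact: runs_nodes.
  apply: (runs_seq B0); first by apply: (runs_assign B0) => //=; solve_bounds.
  apply: (runs_seq B0); first by apply: (runs_assign B0) => //=; solve_bounds.
  apply: (runs_seq B0); first exact: runs_edges.
  apply: (runs_seq B0); first by apply: (runs_assign B0) => //=; solve_bounds.
  apply: (runs_seq B0); first exact: runs_leaves.
  apply: (runs_assign B0).
    by rewrite /bounded /all; do ?[apply/andP; split] => //; lia.
  by rewrite /enc_star lifeE.
- rewrite /=; nia.
Qed.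

End StarProgram.

(** * The program reading off the leaves *)

Lemma data_size_mem (T : eqType) (enc : T -> data) (l : seq T) x :
  x \in l -> data_size (enc x) < data_size (enc_seq enc l).
Proof.
elim: l => //= y l IHl; rewrite in_cons => /orP[/eqP ->|/IHl]; rewrite /=.
  by have := data_size_gt0 (enc_seq enc l); lia.
lia.
Qed.

(** After the encoded graph is dropped, the first loop projects the pairs but reverses their order,
    which the second loop restores. First components are leaves because the centre is the largest
    node. *)
Definition firsts_program : cmd :=
  CSeq (CAssign 0 (ETl (EVar 0)))
 (CSeq (CWhile (EVar 0)
         (CSeq (CAssign 1 (ECons (EHd (EHd (EVar 0))) (EVar 1)))
               (CAssign 0 (ETl (EVar 0)))))
       (CWhile (EVar 1)
         (CSeq (CAssign 0 (ECons (EHd (EVar 1)) (EVar 0)))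
               (CAssign 1 (ETl (EVar 1)))))).

Lemma runs_firsts_program x (l : seq (nat * nat)) N :
  data_size (DCons x (enc_seq enc_np l)) <= N ->
  runs (10 * (N * N)) firsts_program [:: DCons x (enc_seq enc_np l); DNil]
    (50 * N) [:: enc_nats [seq e.1 | e <- l]; DNil].
Proof.
move=> xlN; set B := 10 * _.
have lN : size l < N.
  apply: leq_trans (size_enc_seq enc_np l) _.
  by apply: leq_trans xlN; rewrite ltnW // ltnS leq_addl.
have elN (e : nat * nat) : e \in l -> data_size (enc_np e) < N.
  move=> /(data_size_mem enc_np) /leq_trans -> //.
  by apply: leq_trans xlN; rewrite ltnW // ltnS leq_addl.
have NB : 10 * N <= B by rewrite /B; nia.
have B0 : 0 < B by lia.
have small (T : eqType) (enc : T -> data) (l' : seq T) :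
    {in l', forall y, data_size (enc y) <= N} -> size l' <= N ->
    data_size (enc_seq enc l') + 2 * N <= B.
  move=> /data_size_enc_seq sz l'N.
  apply: leq_trans (_ : N * N.+1 + 1 + 2 * N <= _); last by rewrite /B; nia.
  by rewrite leq_add2r (leq_trans sz) // leq_add2r leq_mul.
have drop_b j : data_size (enc_seq enc_np (drop j l)) + 2 * N <= B.
  apply: small => [e /mem_drop/elN|]; first lia.
  by rewrite size_drop (leq_trans (leq_subr _ _)) // ltnW.
have firsts_b (l' : seq (nat * nat)) : {subset l' <= l} -> size l' <= size l ->
    data_size (enc_nats [seq e.1 | e <- l']) + 2 * N <= B.
  move=> l'l l'N; apply: small => [i /mapP[e /l'l/elN]|].
    by rewrite /= => ? ->; lia.
  by rewrite size_map ltnW // (leq_ltn_trans l'N).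
have size_take_le j : size (take j l) <= size l.
  by rewrite size_take; case: ltnP; lia.
have rev_take_b j : data_size (enc_nats [seq e.1 | e <- rev (take j l)]) + 2 * N <= B.
  by apply: firsts_b => [e|]; rewrite ?mem_rev ?size_rev // => /mem_take.
have drop1_b j : data_size (enc_nats [seq e.1 | e <- drop j l]) + 2 * N <= B.
  by apply: firsts_b => [e /mem_drop //|]; rewrite size_drop leq_subr.
pose st1 j := [:: enc_seq enc_np (drop j l); enc_nats [seq e.1 | e <- rev (take j l)]].
(* The second loop moves items back starting from the end: after [j] rounds register 0 holds the
   last [j] of them. *)
pose st2 j := [:: enc_nats [seq e.1 | e <- drop (size l - j) l];
                 enc_nats [seq e.1 | e <- rev (take (size l - j) l)]].
apply: runs_le; first apply: (runs_seq B0 (l1 := st1 0)).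
- apply: (runs_assign B0) => //.
    by rewrite /bounded /all; apply/and3P; split=> //; lia.
  by rewrite /st1 drop0 take0.
- apply: (runs_seq B0 (l1 := st1 (size l))).
    apply: (runs_while B0 (T := 20)).
    + move=> j _; have := drop_b j; have := rev_take_b j; solve_bounds.
    + by move=> j jl; rewrite /st1 (drop_nth (0, 0)).
    + by rewrite /st1 drop_size.
    + move=> j jl; have := drop_b j; have := rev_take_b j; have := rev_take_b j.+1.
      have dE : drop j l = nth (0, 0) l j :: drop j.+1 l by rewrite (drop_nth (0, 0)).
      rewrite /st1 (take_nth (0, 0)) // rev_rcons dE /= => h1 h2 h3.
      apply: runs_le; first apply: (runs_seq B0).
      * by apply: (runs_assign B0) => //=; solve_bounds.
      * by apply: (runs_assign B0) => //=; solve_bounds.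
      * by [].
  have -> : st1 (size l) = st2 0 by rewrite /st1 /st2 subn0 drop_size.
  have -> : [:: enc_nats [seq e.1 | e <- l]; DNil] = st2 (size l).
    by rewrite /st2 subnn drop0 take0.
  apply: (runs_while B0 (T := 20)).
  + move=> j _; have := drop1_b (size l - j); have := rev_take_b (size l - j).
    solve_bounds.
  + move=> j jl; rewrite /st2 -subSS subSn // (take_nth (0, 0)) ?rev_rcons //.
    by lia.
  + by rewrite /st2 subnn take0.
  + move=> j jl; rewrite /st2; have -> : size l - j = (size l - j.+1).+1 by lia.
    set k := size l - j.+1; have kl : k < size l by rewrite /k; lia.
    have := drop1_b k; have := drop1_b k.+1; have := rev_take_b k.+1.
    have dE : drop k l = nth (0, 0) l k :: drop k.+1 l by rewrite (drop_nth (0, 0)).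
    rewrite (take_nth (0, 0)) // rev_rcons dE /= => h1 h2 h3.
    apply: runs_le; first apply: (runs_seq B0).
    * by apply: (runs_assign B0) => //=; solve_bounds.
    * by apply: (runs_assign B0) => //=; solve_bounds.
    * by [].
- by rewrite /=; lia.
Qed.

(** * Encodings of graphs *)

Lemma exec_runs B c x T y k l' : runs B c (x :: nseq k DNil) T (y :: l') ->
  exists t s, [/\ exec c (init_store x) t s, s 0 = y & t <= T * B].
Proof.
move=> r; have [|t [s [ex tT sl]]] := r (init_store x).
  by case=> [|i] //; rewrite /init_store /update /= nth_nseq if_same.
by exists t, s; split=> //; rewrite sl.
Qed.

Lemma enc_seq_map (S T : Type) (enc : T -> data) (h : S -> T) l :
  enc_seq enc (map h l) = enc_seq (enc \o h) l.
Proof. by elim: l => //= x l ->. Qed.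

Lemma eq_in_enc_seq (T : eqType) (enc enc' : T -> data) (l : seq T) :
  {in l, enc =1 enc'} -> enc_seq enc l = enc_seq enc' l.
Proof.
elim: l => //= x l IHl e; rewrite e ?mem_head // IHl // => y yl.
by apply: e; rewrite in_cons yl orbT.
Qed.

(** Slot [k] ends at [4k+3] while a later slot starts at [4k+6] or after, which gives the strict gap
    demanded between consecutive intervals. *)
Lemma valid_slot_intervals K (ks : seq nat) : ks != [::] -> sorted ltn ks ->
  all (fun k => k < K) ks ->
  valid_intervals (star_lifetime K) (map slot_interval ks).
Proof.
move=> ks0 sks ksK; apply/and3P; split; first by case: ks ks0 {sks ksK}.
  case: ks sks {ks0 ksK} => //= k ks; rewrite leqnn /=.
  elim: ks k => //= k' ks IHks k /andP[kk' /IHks ->].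
  by rewrite ltnSn !andbT; lia.
rewrite all_map; apply/allP => k /(allP ksK) kK /=.
by rewrite /star_lifetime; lia.
Qed.

Definition nat_edges n (E : {set {set 'I_n}}) : seq (nat * nat) :=
  [seq (val p.1, val p.2) | p <- edge_seq E].

Lemma mem_edge_seq n (E : {set {set 'I_n}}) (u v : 'I_n) :
  ((u, v) \in edge_seq E) = (u < v) && ([set u; v] \in E).
Proof.
by rewrite mem_filter allpairs_f ?mem_enum ?andbT.
Qed.

Lemma enc_edge_setE (H : graph) (E : {set {set node H}}) :
  enc_edge_set E = enc_seq enc_np (nat_edges E).
Proof. by rewrite /enc_edge_set enc_seq_map; apply: eq_in_enc_seq. Qed.

Lemma enc_node_setE (H : graph) (A : {set node H}) :
  enc_node_set A = enc_nats [seq val i | i <- enum A].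
Proof. by rewrite enc_seq_map. Qed.

Lemma val_enum_setT n : [seq val i | i <- enum [set: 'I_n]] = iota 0 n.
Proof. by rewrite -val_enum_ord; congr map; apply: eq_enum => i; rewrite inE. Qed.

Lemma enc_graphE (G : graph) : enc_graph G =
  DCons (enc_nats (iota 0 (num_nodes G))) (enc_seq enc_np (nat_edges (edges G))).
Proof. by rewrite /enc_graph enc_node_setE val_enum_setT enc_edge_setE. Qed.

Lemma nat_edges_lt n (E : {set {set 'I_n}}) :
  {in nat_edges E, forall e : nat * nat, (e.1 < n) && (e.2 < n)}.
Proof. by move=> _ /mapP[[u v] _ ->] /=; rewrite !ltn_ord. Qed.

Lemma adjacent_irr (G : graph) (u : node G) : adjacent u u = false.
Proof.
apply/negP => /edges_card2; by rewrite setUid cards1.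
Qed.

Lemma adjacent_sym (G : graph) (u v : node G) : adjacent u v = adjacent v u.
Proof. by rewrite /adjacent setUC. Qed.

(** * The star of a graph *)

Definition leaf n (i : 'I_n) : 'I_n.+1 := widen_ord (leqnSn n) i.

Definition spoke n (i : 'I_n) : {set 'I_n.+1} := [set leaf i; ord_max].

Definition spokes n : {set {set 'I_n.+1}} := [set spoke i | i : 'I_n].

Lemma leaf_inj n : injective (@leaf n).
Proof. by move=> i j /(congr1 val) /= /val_inj. Qed.

Lemma leaf_neq_max n (i : 'I_n) : leaf i == ord_max = false.
Proof. by apply/negbTE; rewrite -val_eqE /= neq_ltn ltn_ord. Qed.

Lemma leaf_in_spoke n (i j : 'I_n) : (leaf i \in spoke j) = (i == j).
Proof. by rewrite !inE leaf_neq_max orbF (inj_eq (@leaf_inj n)). Qed.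

Lemma spoke_inj n : injective (@spoke n).
Proof.
by move=> i j ij; apply/eqP; rewrite -leaf_in_spoke -ij leaf_in_spoke.
Qed.

Lemma leafP n (v : 'I_n.+1) : v != ord_max -> exists i, v = leaf i.
Proof.
move=> v_max; have vn : v < n.
  by move: v_max (ltn_ord v); rewrite -val_eqE /=; lia.
by exists (Ordinal vn); apply: val_inj.
Qed.

Lemma spokes_card2 n e : e \in spokes n -> #|e| = 2.
Proof. by case/imsetP => i _ ->; rewrite cards2 leaf_neq_max. Qed.

Lemma mem_spokes n (u v : 'I_n.+1) :
  ([set u; v] \in spokes n) = (u == ord_max) (+) (v == ord_max).
Proof.
apply/imsetP/idP => [[i _ e]|].
  have : u \in spoke i by rewrite -e set21.
  have : v \in spoke i by rewrite -e set22.
  have : u != v.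
    have : #|[set u; v]| = 2 by rewrite e (@spokes_card2 n) ?imset_f.
    by rewrite cards2; case: (u != v).
  rewrite !inE => uv /orP[] /eqP vE /orP[] /eqP uE; move: uv;
    by rewrite uE vE ?leaf_neq_max ?eqxx.
case: (eqVneq u ord_max) => [->|/leafP[i ->]];
  case: (eqVneq v ord_max) => [->|/leafP[j ->]] //= _.
- by exists j => //; rewrite /spoke setUC.
- by exists i.
Qed.

Definition star n : graph := Graph (@spokes_card2 n).

(** Any two nodes are joined through the centre. A cycle with at least three nodes would visit the
    centre twice, since both neighbours of a leaf on it would be the centre. *)
Lemma star_is_tree n : is_tree (star n).
Proof.
have adjE (u v : node (star n)) :
  adjacent u v = (u == ord_max) (+) (v == ord_max) := mem_spokes u v.
split=> //.
  have toC (u : node (star n)) : connect (@adjacent (star n)) u ord_max.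
    case: (eqVneq u ord_max) => [->|u_max]; first exact: connect0.
    by apply: connect1; rewrite adjE (negPf u_max) eqxx.
  move=> u v; apply: connect_trans (toC u) _.
  by rewrite (sym_connect_sym (@adjacent_sym (star n))).
case=> [|a [|b [|c r]]] //= /andP[/= /and3P[]].
rewrite !adjE => ab bc cr; rewrite !inE !negb_or -!andbA.
case/and4P => anb anc _ /and3P[bnc bnr _].
(* [d] is the successor of [c] on the cycle: the head of [r], or [a] when the cycle has length
   three. If [b] is a leaf, then [a] and [c] are both the centre; otherwise [b] and [d] are. *)
have {cr} [d cd dE] : exists2 d, (c == ord_max) (+) (d == ord_max) & d != b.
  case: r cr bnr {anc bnc} => [|d r] /= /andP[]; rewrite adjE => cd _.
    by exists a.
  by rewrite inE negb_or => /andP[bd _]; exists d => //; rewrite eq_sym.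
move: ab bc cd.
case: (eqVneq b ord_max) => [bE|_]; rewrite ?addbT ?addbF.
  case: (eqVneq d ord_max) => [dE'|_]; first by rewrite dE' bE eqxx in dE.
  by rewrite addbF => _ /negP.
by move=> /eqP aE /eqP cE; rewrite aE cE eqxx in anc.
Qed.

(** * Matchings of the star and independent sets of the graph *)

Section StarReduction.

Variable G : graph.
Let n := num_nodes G.
Let E := nat_edges (edges G).

(** Defined on every set of nodes, as a temporal graph requires. The centre selects no slot, because
    the endpoints recorded in slots are below [n]. *)
Definition star_intervals (e : {set node (star n)}) : seq (nat * nat) :=
  [seq slot_interval p.2 | p <- slots n E
     & (inord p.1.1 \in e) || (inord p.1.2 \in e)].

Lemma star_intervalsE (i : 'I_n) : star_intervals (spoke i) = leaf_intervals n E i.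
Proof.
have inordE u : u < n -> (inord u \in spoke i) = (u == i).
  move=> un; have -> : inord u = leaf (Ordinal un).
    by apply: val_inj; rewrite /= inordK // ltnW.
  exact: leaf_in_spoke.
congr map; apply: eq_in_filter => p /(slots_lt (@nat_edges_lt _ _)).
by case/and3P => p1 p2 _; rewrite !inordE.
Qed.

Lemma self_slot (i : 'I_n) : ((val i, val i), val i) \in slots n E.
Proof.
apply/(nthP ((0, 0), 0)); exists i; first by rewrite size_slots ltn_addr.
rewrite nth_zip ?size_items ?size_iota // nth_iota ?ltn_addr //.
by rewrite nth_cat size_map size_iota ltn_ord (nth_map 0) ?size_iota ?nth_iota.
Qed.

Lemma star_intervals_valid e : e \in edges (star n) ->
  valid_intervals (star_lifetime (n + size E)) (star_intervals e).
Proof.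
case/imsetP => i _ ->; rewrite star_intervalsE /leaf_intervals map_comp.
apply: valid_slot_intervals.
- have : (val i, val i, val i) \in [seq p <- slots n E | hits i p].
    by rewrite mem_filter self_slot /hits eqxx.
  by case: [seq _ <- _ | _].
- apply: (subseq_sorted ltn_trans) (iota_ltn_sorted 0 (n + size E)).
  rewrite -[X in subseq _ X](@unzip2_zip _ _ (items n E) (iota 0 (n + size E))).
    exact/map_subseq/filter_subseq.
  by rewrite size_items size_iota.
- rewrite all_map; apply/allP => p; rewrite mem_filter => /andP[_].
  by move=> /(slots_lt (@nat_edges_lt _ _))/and3P[].
Qed.

Definition star_tree : rooted_temporal_tree :=
  @RootedTemporalTree (TemporalGraph star_intervals_valid)
    (ord_max : node (star n)) (star_is_tree n).

(** Slot intervals have length one, so the start is their only timestep. *)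
Lemma exists_at_spoke (i : 'I_n) t :
  reflect (exists p k, [/\ (p, k) \in slots n E, hits i (p, k)
                         & t = (slot_interval k).1])
    (@exists_at star_tree (spoke i) t).
Proof.
rewrite /exists_at /= star_intervalsE.
apply: (iffP hasP) => [[x /mapP[[p k] pk ->]]|[p [k [pk hp ->]]]].
  move: pk; rewrite mem_filter => /andP[hp pk] /= tk.
  by exists p, k; split=> //; lia.
exists (slot_interval k); last by rewrite /= leqnn /=.
by apply/mapP; exists (p, k); rewrite // mem_filter hp.
Qed.

(** Distinct slots have distinct timesteps, so a common timestep is a common slot. A slot hit by two
    different leaves cannot hold a diagonal item, hence it holds the edge joining them; conversely,
    the slot of an edge is hit by both its ends. *)
Lemma overlap_spoke (i j : 'I_n) :
  @overlap star_tree (spoke i) (spoke j) = @adjacent G i j.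
Proof.
apply/and3P/idP => [[ij _ /existsP[t /andP[]]]|].
  move=> /exists_at_spoke[p [k [pk hi tk]]] /exists_at_spoke[q [k' [qk hj tk']]].
  have kk' : k = k' by move: tk'; rewrite tk /=; lia.
  have pq : p = q.
    by have [_ ->] := mem_slots pk; have [_ ->] := mem_slots qk; rewrite kk'.
  move: hi hj; rewrite -{}pq /hits /=.
  have {}ij : i != j by apply: contraNneq ij => ->.
  have [kK pE] := mem_slots pk.
  have : p \in items n E by rewrite pE mem_nth // size_items.
  rewrite mem_cat => /orP[/mapP[m _ ->] /=|/mapP[[u v] /= uvE ->] /=].
    by rewrite !orbb => /eqP -> /eqP/val_inj eij; rewrite eij eqxx in ij.
  move: uvE; rewrite mem_edge_seq /adjacent => /andP[_ uvE].
  case/orP=> /eqP/val_inj ui /orP[] /eqP/val_inj uj; move: ij uvE;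
    rewrite -{}ui -{}uj ?eqxx //.
  by rewrite setUC.
move=> adj; have ij : i != j.
  by apply: contraTneq adj => ->; rewrite adjacent_irr.
split; first by apply: contra ij => /eqP/spoke_inj ->.
  by apply/set0Pn; exists ord_max; rewrite !inE eqxx !orbT.
have [p [k [pk hi hj]]] : exists p k,
    [/\ (p, k) \in slots n E, hits i (p, k) & hits j (p, k)].
  suff [p pE hp] : exists2 p, p \in items n E
      & forall k, hits i (p, k) && hits j (p, k).
    exists p, (index p (items n E)).
    have [hi hj] := andP (hp (index p (items n E))); split=> //.
    apply/(nthP ((0, 0), 0)); exists (index p (items n E)).
      by rewrite size_slots -size_items index_mem.
    rewrite nth_zip ?size_items ?size_iota // nth_index // nth_iota //.
    by rewrite -size_items index_mem.
  (* Edges are listed with the smaller endpoint first, so the order of [i] and [j] decides which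
     pair is the item. *)
  have [ltij|ltji] : i < j \/ j < i by move: ij; rewrite -val_eqE /=; lia.
    exists (val i, val j); last by move=> k; rewrite /hits /= !eqxx orbT.
    rewrite mem_cat; apply/orP; right; apply/mapP; exists (i, j) => //.
    by rewrite mem_edge_seq ltij.
  exists (val j, val i); last by move=> k; rewrite /hits /= !eqxx orbT.
  rewrite mem_cat; apply/orP; right; apply/mapP; exists (j, i) => //.
  by rewrite mem_edge_seq ltji setUC.
have [kK _] := mem_slots pk.
have tK : (slot_interval k).1 < star_lifetime (n + size E).
  by rewrite /star_lifetime /=; lia.
apply/existsP; exists (Ordinal tK).
by apply/andP; split; apply/exists_at_spoke; exists p, k.
Qed.

Definition leaves_of (M : {set {set node (star n)}}) : {set node G} :=
  [set i | spoke i \in M].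

Lemma spoke_leaves_of (M : {set {set node (star n)}}) :
  M \subset edges (star n) -> [set spoke i | i in leaves_of M] = M.
Proof.
move=> /subsetP MS; apply/setP => e; apply/imsetP/idP => [[i]|eM].
  by rewrite inE => iM ->.
by have /imsetP[i _ eE] := MS e eM; exists i => //; rewrite inE -eE.
Qed.

Lemma card_leaves_of (M : {set {set node (star n)}}) :
  M \subset edges (star n) -> #|leaves_of M| = #|M|.
Proof.
by move=> MS; rewrite -{2}(spoke_leaves_of MS) card_imset //; apply: spoke_inj.
Qed.

Lemma independent_leaves_of (M : {set {set node (star n)}}) :
  @timed_matching star_tree M -> independent (leaves_of M).
Proof.
case/andP=> _ /forall_inP MM; apply/forall_inP => i; rewrite inE => iM.
apply/forall_inP => j; rewrite inE => jM; rewrite -overlap_spoke.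
by have /forall_inP := MM _ iM; apply.
Qed.

Lemma timed_matching_spokes (I : {set node G}) : independent I ->
  @timed_matching star_tree [set spoke i | i in I].
Proof.
move=> /forall_inP II; apply/andP; split; first exact/imsetS/subsetP.
apply/forall_inP => _ /imsetP[i iI ->].
apply/forall_inP => _ /imsetP[j jI ->]; rewrite overlap_spoke.
by have /forall_inP := II _ iI; apply.
Qed.

Lemma OPT_star : @OPT MAX_01_TMT_MULT star_tree = @OPT MAX_IS G.
Proof.
apply/eqP; rewrite eqn_leq; apply/andP; split; apply/bigmax_leqP => /= X FX.
  have MS : X \subset edges (star n) by case/andP: FX.
  rewrite -(card_leaves_of MS).
  exact: (@leq_bigmax_cond _ (fun I : {set node G} => independent I)
    (fun I : {set node G} => #|I|) _ (independent_leaves_of FX)).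
rewrite -(card_imset _ (@spoke_inj n)).
exact: (@leq_bigmax_cond _ (@timed_matching star_tree)
    (fun M : {set {set node (star n)}} => #|M|) _ (timed_matching_spokes FX)).
Qed.

(** The lexicographic list of pairs is cut into rows by first component: the row of leaf [i] keeps
    at most its pair with the centre, and the row of the centre, the largest node, keeps nothing.
    The order of the leaves is therefore preserved. *)
Lemma edge_seq_star (M : {set {set node (star n)}}) :
  M \subset edges (star n) ->
  edge_seq M = [seq (leaf i, ord_max) | i <- enum (leaves_of M)].
Proof.
move=> /subsetP MS; rewrite /edge_seq.
set s := enum 'I_n.+1.
pose P (p : 'I_n.+1 * 'I_n.+1) := (p.1 < p.2) && ([set p.1; p.2] \in M).
rewrite -[filter _ _]/[seq p <- _ | P p].
have sE : s = rcons [seq leaf i | i <- enum 'I_n] ord_max by rewrite /s enum_ordSr.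
have filter0 (t : seq ('I_n.+1 * 'I_n.+1)) : {in t, forall p, ~~ P p} ->
    [seq p <- t | P p] = [::].
  by move=> /hasPn; rewrite has_filter negbK => /eqP.
have Fleaf (i : 'I_n) : [seq p <- [seq (leaf i, v) | v <- s] | P p] =
    if spoke i \in M then [:: (leaf i, ord_max)] else [::].
  rewrite sE map_rcons filter_rcons {1}/P /= ltn_ord -/(spoke i) /= filter0 //.
  move=> _ /mapP[_ /mapP[j _ ->] ->]; apply/nandP; right.
  by apply/negP => /MS /=; rewrite mem_spokes !leaf_neq_max.
have Fmax : [seq p <- [seq (ord_max, v) | v <- s] | P p] = [::].
  by apply: filter0 => _ /mapP[v _ ->]; rewrite /P /= ltnNge -ltnS ltn_ord.
have -> : enum (leaves_of M) = [seq i <- enum 'I_n | spoke i \in M].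
  by rewrite enumT /enum_mem; apply: eq_filter => i; rewrite !inE.
rewrite filter_flatten -map_comp [X in flatten (map _ X)]sE map_rcons.
rewrite flatten_rcons /= Fmax cats0.
rewrite -map_comp; elim: (enum _) => //= i t IHt.
by rewrite Fleaf IHt; case: (spoke i \in M).
Qed.

Lemma nat_edges_star (M : {set {set node (star n)}}) :
  M \subset edges (star n) ->
  nat_edges M = [seq (val i, n) | i <- enum (leaves_of M)].
Proof. by move=> MS; rewrite /nat_edges edge_seq_star // -map_comp. Qed.

Lemma enc_star_tree : enc_rooted_temporal_tree star_tree = enc_star n E.
Proof.
rewrite /enc_rooted_temporal_tree /enc_star enc_node_setE val_enum_setT.
congr (DCons _ (DCons _ (DCons _ _))).
rewrite edge_seq_star // enc_seq_map -val_enum_ord enc_seq_map.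
have -> : leaves_of (edges (underlying star_tree)) = setT.
  by apply/setP => i; rewrite !inE imset_f.
rewrite (eq_enum (in_setT (T := _))).
apply: eq_in_enc_seq => i _ /=; by rewrite -star_intervalsE.
Qed.

End StarReduction.

(** * The approximation preserving reduction *)

Theorem theorem5 :
  exists (f : instance MAX_IS -> instance MAX_01_TMT_MULT)
    (g : forall G : instance MAX_IS, candidate (f G) -> candidate G),
    @approximation_preserving MAX_IS MAX_01_TMT_MULT f g.
Proof.
exists star_tree, leaves_of; split.
- exists star_program.
  (* The time [600 * N^2] multiplied by its unit [B = 10 * (100 * N^3)], with [N] the size of the
     input. *)
  exists ((600%N)%:P * 'X^2 * ((10%N)%:P * ((100%N)%:P * 'X^3)))%R => G _.
  change (enc_instance G) with (enc_graph G).
  rewrite enc_graphE; set x := DCons _ _.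
  (* An encoded list is larger than its length, so the size of the input strictly exceeds the number
     of slots. *)
  have [||l r] := @runs_star_program (num_nodes G) (nat_edges (edges G))
    (data_size x) (@nat_edges_lt _ _) _ _ => //.
    have := size_enc_seq enc_nat (iota 0 (num_nodes G)); rewrite size_iota.
    have := size_enc_seq enc_np (nat_edges (edges G)); rewrite /x /=; lia.
  have [t [s [ex s0 tT]]] := exec_runs (k := 10) r.
  exists t, s; split=> //; first by rewrite s0 -enc_star_tree.
  rewrite (leq_trans tT) //.
  rewrite hornerM !hornerCM !hornerXn; exact: leqnn.
- exists firsts_program, ((50%N)%:P * 'X * ((10%N)%:P * 'X^2))%R => -[G M] /andP[/= MS _].
  have [t [s [ex s0 tT]]] := exec_runs (k := 1) (@runs_firsts_program
    (enc_graph G) (nat_edges M) _ (leqnn _)).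
  rewrite -(@enc_edge_setE (star (num_nodes G)) M) in ex tT.
  exists t, s; split=> //.
    by rewrite s0 nat_edges_star // -map_comp enc_node_setE.
  rewrite (leq_trans tT) // hornerM !hornerCM hornerX hornerXn; exact: leqnn.
- by move=> G M; apply: independent_leaves_of.
- move=> R rho G M [FM approx]; split; first exact: independent_leaves_of.
  (* Optimum and value are both unchanged, so the inequality for [M] is literally the one required,
     whatever the sign or size of [rho]. *)
  rewrite -OPT_star /= card_leaves_of //; by case/andP: FM.
Qed.
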